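(* For any prime power $q$, the collinearity graph of the polar space $\mathcal{Q}^-(5,q)$ is triply-transitive.
   Context: The collinearity graph of $\mathcal{Q}^-(5,q)$: on $V=\mathbb{F}_q^6$ let $Q(\boldsymbol{x})=x_1x_2+x_3x_4+f(x_5,x_6)$, where $f$ is a homogeneous quadratic polynomial irreducible over $\mathbb{F}_q$, and $B(\boldsymbol{x},\boldsymbol{y})=Q(\boldsymbol{x}+\boldsymbol{y})-Q(\boldsymbol{x})-Q(\boldsymbol{y})$. The vertices are the $1$-dimensional subspaces $\langle\boldsymbol{x}\rangle$ with $\boldsymbol{x}\neq\boldsymbol{0}$ and $Q(\boldsymbol{x})=0$; two distinct vertices $\langle\boldsymbol{x}\rangle,\langle\boldsymbol{y}\rangle$ are adjacent iff $B(\boldsymbol{x},\boldsymbol{y})=0$. A graph $\Gamma=(\Omega,E)$ is strongly regular with parameters $(v,k,\lambda,\mu)$ if it has $v$ vertices, is $k$-regular, every pair of adjacent vertices has exactly $\lambda$ common neighbours, and every pair of distinct non-adjacent vertices has exactly $\mu$ common neighbours. Triply-transitive. Let $\Gamma=(\Omega,E)$ be strongly regular. Let $A_0=I$, let $A_1$ be the adjacency matrix of $\Gamma$ and $A_2$ the adjacency matrix of its complement. For $\omega\in\Omega$ let $\Delta_0(\omega)=\{\omega\}$, let $\Delta_1(\omega)$ be the set of neighbours of $\omega$, and let $\Delta_2(\omega)$ be the set of vertices different from and not adjacent to $\omega$. For $i=0,1,2$ let $E^*_{i,\omega}$ be the diagonal $0/1$ matrix (indexed by $\Omega$) with $(\alpha,\alpha)$-entry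 $1$ iff $\alpha\in\Delta_i(\omega)$. Define - $T_{0,\omega}=\operatorname{Span}_{\mathbb{C}}\{E^*_{i,\omega}A_jE^*_{k,\omega}: i,j,k\in\{0,1,2\}\}$; - $T_\omega$, the Terwilliger algebra: the subalgebra of $\mathrm{Mat}_{|\Omega|}(\mathbb{C})$ generated by $A_0,A_1,A_2,E^*_{0,\omega},E^*_{1,\omega},E^*_{2,\omega}$; - $\widetilde{T}_\omega=\{X\in \mathrm{Mat}_{|\Omega|}(\mathbb{C}): P_gX=XP_g \text{ for all } g\in \mathrm{Aut}(\Gamma)_\omega\}$, where $\mathrm{Aut}(\Gamma)_\omega$ is the stabilizer of $\omega$ in the full automorphism group of $\Gamma$ and $P_g$ is the permutation matrix of $g$. Then $T_{0,\omega}\subseteq T_\omega\subseteq\widetilde{T}_\omega$. The graph $\Gamma$ is triply-transitive if it is vertex-transitive and $T_{0,\omega}=T_\omega=\widetilde{T}_\omega$ for any vertex $\omega$. *)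

(* Defs.v *)
From HB Require Import structures.
From mathcomp Require Import all_boot all_order all_algebra all_fingroup.
From mathcomp Require Import complex reals classical_sets.
From mathcomp Require Import mpoly.

Set Implicit Arguments.
Unset Strict Implicit.
Unset Printing Implicit Defensive.

Import GRing.Theory.
Local Open Scope ring_scope.

(* Finite simple graphs are given by a symmetric irreflexive relation [e] on a
   finite type [T]; these two properties are part of [strongly_regular]. *)

Definition strongly_regular (T : finType) (e : rel T) (v k lam mu : nat) : Prop :=
  [/\ ssrbool.symmetric e /\ irreflexive e,
      #|T| = v,
      forall x, #|[set y | e x y]| = k,
      forall x y, e x y -> #|[set z | e x z && e y z]| = lam &
      forall x y, x != y -> ~~ e x y -> #|[set z | e x z && e y z]| = mu].

Definition graph_aut (T : finType) (e : rel T) : {set {perm T}} :=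
  [set g : {perm T} | [forall x, forall y, e (g x) (g y) == e x y]].

Lemma graph_aut_group_set (T : finType) (e : rel T) : group_set (graph_aut e).
Proof.
apply/group_setP; split=> [|g h].
  by rewrite inE; apply/forallP=> x; apply/forallP=> y; rewrite !perm1.
rewrite !inE => /forallP Hg /forallP Hh.
apply/forallP=> x; apply/forallP=> y; rewrite !permM.
by rewrite (eqP (forallP (Hh _) _)); exact: (forallP (Hg x) y).
Qed.

Canonical graph_aut_group (T : finType) (e : rel T) :=
  Group (graph_aut_group_set e).

(* The identity, adjacency and distinct-and-non-adjacent relations, for
   i = 0, 1, 2. *)
Definition assoc_rel (T : finType) (e : rel T) (i : 'I_3) : rel T :=
  fun x y => match val i with
             | 0%N => x == y
             | 1%N => e x y
             | _ => (x != y) && ~~ e x y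
             end.

Definition subconstituent (T : finType) (e : rel T) (i : 'I_3) (w : T) :
  {set T} := [set x | assoc_rel e i w x].

(* Matrices indexed by [T] are elements of ['M_#|T|], the index [i] standing
   for the element [enum_val i] of [T]. *)
Section Terwilliger.
Variables (C : fieldType) (T : finType) (e : rel T).

Definition adj_mx (i : 'I_3) : 'M[C]_#|T| :=
  \matrix_(a, b) (assoc_rel e i (enum_val a) (enum_val b))%:R.

Definition dual_idem (i : 'I_3) (w : T) : 'M[C]_#|T| :=
  diag_mx (\row_a (enum_val a \in subconstituent e i w)%:R).

Definition perm_mx_on (g : {perm T}) : 'M[C]_#|T| :=
  \matrix_(a, b) (g (enum_val a) == enum_val b)%:R.

Definition terwilliger0 (w : T) : set 'M[C]_#|T| :=
  fun X => X \in
    <<[seq dual_idem p.1.1 w *m adj_mx p.1.2 *m dual_idem p.2 w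
      | p : 'I_3 * 'I_3 * 'I_3]>>%VS.

(* Since ['M_#|T|] has finite dimension, its subalgebras are among its
   (detachable) subspaces; the generated one is their intersection. *)
Definition terwilliger (w : T) : set 'M[C]_#|T| :=
  fun X => forall U : {vspace 'M[C]_#|T|},
    1%:M \in U ->
    (forall Y Z, Y \in U -> Z \in U -> Y *m Z \in U) ->
    (forall i, adj_mx i \in U) ->
    (forall i, dual_idem i w \in U) ->
    X \in U.

Definition terwilliger_tilde (w : T) : set 'M[C]_#|T| :=
  fun X => forall g, g \in 'C_(graph_aut e)[w | 'P]%g ->
    perm_mx_on g *m X = X *m perm_mx_on g.

End Terwilliger.

Definition triply_transitive (R : realType) (T : finType) (e : rel T) : Prop :=
  [/\ exists v k lam mu, strongly_regular e v k lam mu,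
      [transitive graph_aut e, on [set: T] | 'P]%g &
      forall w : T,
        terwilliger0 e w = terwilliger e w :> set ('M[R[i]]_#|T|) /\
        terwilliger e w = terwilliger_tilde e w :> set ('M[R[i]]_#|T|)].

Definition irreducible_elt (A : idomainType) (a : A) : Prop :=
  [/\ a != 0, a \isn't a GRing.unit &
      forall b c, a = b * c -> b \is a GRing.unit \/ c \is a GRing.unit].

HB.instance Definition _ (F : finFieldType) (vT : vectType F) :=
  Choice_isCountable.Build {vspace vT}
    (pcan_pickleK (can_pcan (@VectorInternalTheory.vs2mxK F vT))).
HB.instance Definition _ (F : finFieldType) (vT : vectType F) :=
  isFinite.Build {vspace vT}
    (pcan_enumP (can_pcan (@VectorInternalTheory.vs2mxK F vT))).

Section EllipticQuadric.
Variables (F : finFieldType) (f : {mpoly F[2]}).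

(* Coordinates are numbered from 0, and [rshift 4 i] is 4 or 5. *)
Definition elliptic_form (x : 'rV[F]_6) : F :=
  x 0 0 * x 0 1 + x 0 2 * x 0 3 + f.@[fun i : 'I_2 => x 0 (rshift 4 i)].

Definition elliptic_bilin (x y : 'rV[F]_6) : F :=
  elliptic_form (x + y) - elliptic_form x - elliptic_form y.

Definition elliptic_point : finType :=
  {U : {vspace 'rV[F]_6} |
    [exists x : 'rV[F]_6,
      [&& x != 0, elliptic_form x == 0 & U == <[x]>%VS]]}.

(* Bilinearity makes the choice of the generators immaterial. *)
Definition elliptic_collinear : rel elliptic_point :=
  fun U W => (U != W) &&
    [exists x : 'rV[F]_6, exists y : 'rV[F]_6,
      [&& val U == <[x]>%VS, val W == <[y]>%VS & elliptic_bilin x y == 0]].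

End EllipticQuadric.

(* Main.v *)
Require Import Defs.
From HB Require Import structures.
From mathcomp Require Import all_boot all_order all_algebra all_fingroup.
From mathcomp Require Import complex reals classical_sets.
From mathcomp Require Import mpoly.
From mathcomp Require Import ring.

(** The matrices in [terwilliger0] are spanned by the indicators of the pairs
    [(x, y)] such that the triple [(w, x, y)] has a prescribed type, the type of a
    triple recording for each of its pairs whether the two vertices are equal,
    adjacent or neither. The matrices in [terwilliger_tilde] are those that are
    constant on the orbits of the stabilizer of [w] on pairs. The three algebras
    therefore coincide as soon as automorphisms are transitive on the ordered
    triples of each type. Vertex-transitivity and strong regularity also follow
    from this homogeneity, without computing any parameter
    ([homogeneous_triply_transitive]).

    For the elliptic quadric this homogeneity is a small case of Witt's theorem,
    extended from isometries to similitudes. The space is an orthogonal sum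
    H + (H + N) of two hyperbolic planes and an anisotropic plane N. Over any
    nondegenerate M, the isometries of H + M are transitive on the nonzero vectors of
    given value ([isometry_to_hyp_plane]). Used once for H + (H + N), it moves a point
    to e1; used for H + N, inside the stabilizer of e1 or of the hyperbolic pair
    (e1, e2), it brings a second and then a third point to a normal form that depends
    only on the type of the triple. Triples are reordered so that a nonadjacent pair
    comes first; three distinct pairwise adjacent points lie on a line, N being
    anisotropic.

    Isometries do not suffice for three pairwise nonadjacent points: if x, y, z
    generate them, the product B(x,y) B(y,z) B(x,z) is defined up to squares and is
    an invariant. Similitudes of H + N with arbitrary multiplier remove it. They
    come from N, which up to a scalar is the norm form of a quadratic extension:
    multiplication by an element of the extension is a similitude of multiplier its
    norm, and the norm is onto ([binary_similitude]). The argument is uniform in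
    the characteristic, except for the nondegeneracy of N and the surjectivity
    of the norm, where characteristic 2 is treated apart. *)

Set Implicit Arguments.
Unset Strict Implicit.
Unset Printing Implicit Defensive.

Import GRing.Theory.

(** * Triply homogeneous graphs are triply transitive *)

Section Graph.
Local Open Scope ring_scope.
Variables (T : finType) (e : rel T).

(** Since [e] is irreflexive, equality and adjacency together say which of the
    three association relations holds. *)
Definition same_rel (x y x' y' : T) :=
  ((x == y) == (x' == y')) && (e x y == e x' y').

Definition triple_homogeneous := forall w x y w' x' y' : T,
  same_rel w x w' x' -> same_rel w y w' y' -> same_rel x y x' y' ->
  exists2 g, g \in graph_aut e & [/\ g w = w', g x = x' & g y = y'].

Hypothesis e_sym : ssrbool.symmetric e.
Hypothesis e_irr : irreflexive e.
Hypothesis e_hom : triple_homogeneous.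

Lemma graph_autE (g : {perm T}) x y : g \in graph_aut e -> e (g x) (g y) = e x y.
Proof. by rewrite inE => /forallP/(_ x)/forallP/(_ y)/eqP. Qed.

Lemma same_relxx x x' : same_rel x x x' x'.
Proof. by rewrite /same_rel !eqxx !e_irr. Qed.

Lemma pair_homogeneous w x w' x' : same_rel w x w' x' ->
  exists2 g, g \in graph_aut e & g w = w' /\ g x = x'.
Proof.
by move=> h; have [g Gg [? ? _]] := e_hom h h (same_relxx x x'); exists g.
Qed.

Lemma homogeneous_transitive (x0 : T) :
  [transitive graph_aut e, on [set: T] | 'P]%g.
Proof.
apply/imsetP; exists x0; first by rewrite inE.
apply/setP=> x; rewrite inE; apply/esym/orbitP.
have [g Gg [gx _]] := pair_homogeneous (same_relxx x0 x).
by exists g.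
Qed.

(** Produces the numbers [k], [lam] and [mu] without computing them: when no pair
    satisfies [r] the constant is arbitrary. *)
Lemma homogeneous_constant (r : rel T) (m : T -> T -> nat) :
  (forall x y x' y', r x y -> r x' y' -> same_rel x y x' y') ->
  (forall g x y, g \in graph_aut e -> m (g x) (g y) = m x y) ->
  exists c, forall x y, r x y -> m x y = c.
Proof.
move=> r_same m_inv; case: (pickP (fun p : T * T => r p.1 p.2)) => [p rp|r0].
  exists (m p.1 p.2) => x y rxy.
  by have [g Gg [<- <-]] := pair_homogeneous (r_same _ _ _ _ rp rxy); exact: m_inv.
by exists 0 => x y rxy; have := r0 (x, y); rewrite /= rxy.
Qed.

Lemma homogeneous_strongly_regular :
  exists v k lam mu, strongly_regular e v k lam mu.
Proof.
have card_inv (g : {perm T}) x y : g \in graph_aut e ->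
  #|[set z | e (g x) z && e (g y) z]| = #|[set z | e x z && e y z]|.
  move=> Gg; rewrite -[RHS](card_imset _ (@perm_inj _ g)); apply: eq_card => z.
  apply/idP/imsetP => [|[t]]; last by rewrite !inE => ? ->; rewrite !graph_autE.
  rewrite inE => h; exists ((g^-1)%g z); rewrite ?permKV //.
  by rewrite inE -(graph_autE x _ Gg) -(graph_autE y _ Gg) permKV.
have [k k_deg] : exists k, forall x y, x == y -> #|[set z | e x z && e y z]| = k.
  apply: (homogeneous_constant (r := eq_op)) => // x y x' y' /eqP -> /eqP->.
  exact: same_relxx.
have [l l_deg] : exists k, forall x y, e x y -> #|[set z | e x z && e y z]| = k.
  apply: (homogeneous_constant (r := e)) => [x y x' y'|//] exy exy'.
  rewrite /same_rel exy exy'.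
  rewrite andbT; have e_neq u v : e u v -> u == v = false.
    by move=> euv; apply: contraTF euv => /eqP->; rewrite e_irr.
  by rewrite !e_neq.
have [mu mu_deg] : exists k, forall x y, (x != y) && ~~ e x y ->
    #|[set z | e x z && e y z]| = k.
  apply: (homogeneous_constant (r := fun x y => (x != y) && ~~ e x y)) => [x y x' y'|//].
  case/andP => /negPf h1 /negPf h2.
  by case/andP => /negPf h3 /negPf h4; rewrite /same_rel h1 h2 h3 h4.
exists #|T|, k, l, mu; split => //.
- move=> x; rewrite -(k_deg x x) //; apply: eq_card => z; by rewrite !inE andbb.
- by move=> x y ne nxy; apply: mu_deg; rewrite ne.
Qed.

Section Algebra.
Variables (C : fieldType) (w : T).

Let G := 'C_(graph_aut e)[w | 'P]%g.

Lemma stabilizerP g : g \in G -> g \in graph_aut e /\ g w = w.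
Proof. by case/setIP => Gg /astab1P. Qed.

Lemma assoc_rel_aut g i x y : g \in graph_aut e ->
  assoc_rel e i (g x) (g y) = assoc_rel e i x y.
Proof.
by move=> Gg; rewrite /assoc_rel (graph_autE _ _ Gg) (inj_eq perm_inj).
Qed.

Definition rel_class (x y : T) : 'I_3 :=
  if x == y then inord 0 else if e x y then inord 1 else inord 2.

Lemma assoc_relE i x y : assoc_rel e i x y = (rel_class x y == i).
Proof.
rewrite /assoc_rel /rel_class -val_eqE /=.
have [->|ne] := eqVneq x y; last case exy: (e x y); rewrite /= !inordK ?e_irr //;
  by case: i => [[|[|[|]]]] // ? /=; rewrite ?exy.
Qed.

Lemma rel_class_same x y x' y' :
  rel_class x y = rel_class x' y' -> same_rel x y x' y'.
Proof.
rewrite /rel_class /same_rel.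
have [->|_] := eqVneq x y; have [->|_] := eqVneq x' y'; rewrite ?e_irr ?eqxx //;
  by do 1?[case: (e x y)]; do 1?[case: (e x' y')] => // /(congr1 val); rewrite /= !inordK.
Qed.

(** The generators of [terwilliger0]; by [blockE] they are the indicator matrices
    of the classes of pairs [(x, y)] for which the triple [(w, x, y)] has a given
    type. *)
Definition block (p : 'I_3 * 'I_3 * 'I_3) : 'M[C]_#|T| :=
  dual_idem C e p.1.1 w *m adj_mx C e p.1.2 *m dual_idem C e p.2 w.

Definition triple_class (x y : T) : 'I_3 * 'I_3 * 'I_3 :=
  (rel_class w x, rel_class x y, rel_class w y).

Lemma blockE p a b :
  block p a b = (triple_class (enum_val a) (enum_val b) == p)%:R.
Proof.
case: p => [[i j] k]; rewrite /block /dual_idem /=.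
rewrite mul_mx_diag mxE mul_diag_mx !mxE /= !inE !assoc_relE.
by rewrite -!natrM !mulnb /triple_class -!pair_eqE /= /pair_eq /= -!pair_eqE.
Qed.

Lemma perm_mx_on_commP g (X : 'M[C]_#|T|) :
  perm_mx_on C g *m X = X *m perm_mx_on C g <->
  forall x y, X (enum_rank (g x)) (enum_rank (g y)) = X (enum_rank x) (enum_rank y).
Proof.
have lE a b : (perm_mx_on C g *m X) a b = X (enum_rank (g (enum_val a))) b.
  rewrite mxE (bigD1 (enum_rank (g (enum_val a)))) //= mxE enum_rankK eqxx mul1r.
  rewrite big1 ?addr0 // => c ne; rewrite mxE; case: eqP => [E|]; rewrite ?mul0r //.
  by rewrite E enum_valK eqxx in ne.
have rE a b : (X *m perm_mx_on C g) a (enum_rank (g (enum_val b))) = X a b.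
  rewrite mxE (bigD1 b) //= mxE enum_rankK eqxx mulr1.
  rewrite big1 ?addr0 // => c ne; rewrite mxE enum_rankK (inj_eq perm_inj).
  by rewrite (inj_eq enum_val_inj) (negPf ne) mulr0.
split=> [E x y|E].
  have := congr1 (fun Z : 'M_#|T| =>
    Z (enum_rank x) (enum_rank (g (enum_val (enum_rank y))))) E.
  by rewrite lE rE !enum_rankK.
apply/matrixP => a b; rewrite lE.
have -> : b = enum_rank (g (enum_val (enum_rank ((g^-1)%g (enum_val b))))).
  by rewrite enum_rankK permKV enum_valK.
by rewrite rE E !enum_valK.
Qed.

Lemma terwilliger0_sub_tilde :
  (@terwilliger0 C T e w `<=` @terwilliger_tilde C T e w)%classic.
Proof.
move=> X X0 g /stabilizerP[Gg gw]; apply/perm_mx_on_commP => x y.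
have class_inv : triple_class (g x) (g y) = triple_class x y.
  by rewrite /triple_class -{1 2}gw /rel_class !(inj_eq perm_inj) !graph_autE.
move: X0; rewrite /terwilliger0 /= -[X in span X]/(val (in_tuple _)) => /coord_span ->.
rewrite !summxE; apply: eq_bigr => i _; rewrite [LHS]mxE [RHS]mxE; congr (_ * _).
have /mapP[p _ ->] := mem_nth 0 (ltn_ord i).
by rewrite -/(block p) !blockE !enum_rankK class_inv.
Qed.

(** This is where homogeneity is used: two pairs in the same class are exchanged
    by an automorphism fixing [w], so a matrix of the centralizer algebra has one
    value per class, and is the combination of the blocks with these values as
    coefficients. *)
Lemma tilde_sub_terwilliger0 :
  (@terwilliger_tilde C T e w `<=` @terwilliger0 C T e w)%classic.
Proof.
move=> X Xg.
pose in_class p (c : T * T) := triple_class c.1 c.2 == p.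
pose coef p := if [pick c | in_class p c] is Some c
               then X (enum_rank c.1) (enum_rank c.2) else 0.
have -> : X = \sum_p coef p *: block p.
  apply/matrixP => a b; set x := enum_val a; set y := enum_val b.
  rewrite summxE (bigD1 (triple_class x y)) //= big1 ?addr0; last first.
    by move=> p ne; rewrite mxE blockE eq_sym (negPf ne) mulr0.
  rewrite mxE blockE eqxx mulr1 /coef; case: pickP => [[x' y']|/(_ (x, y))]; last first.
    by rewrite /in_class /= eqxx.
  rewrite /in_class /= => /eqP[c1 c2 c3].
  have [g Gg [gw gx gy]] := e_hom (rel_class_same c1) (rel_class_same c3)
                                  (rel_class_same c2).
  have /perm_mx_on_commP/(_ x' y') <- : perm_mx_on C g *m X = X *m perm_mx_on C g.
    by apply: Xg; apply/setIP; split=> //; apply/astab1P.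
  by rewrite gx gy !enum_valK.
rewrite /terwilliger0 /=; apply: memv_suml => p _; apply: memvZ.
by apply: memv_span; apply: map_f; rewrite mem_enum.
Qed.

Lemma terwilliger0_sub_terwilliger :
  (@terwilliger0 C T e w `<=` @terwilliger C T e w)%classic.
Proof.
move=> X X0 U _ U_mul U_adj U_dual.
suff /subvP : (<<[seq block p | p : 'I_3 * 'I_3 * 'I_3]>> <= U)%VS by apply.
apply/span_subvP => _ /mapP[p _ ->].
by apply: (U_mul _ _ (U_mul _ _ (U_dual _) (U_adj _)) (U_dual _)).
Qed.

(** The span of the blocks equals the centralizer algebra, hence is closed under
    products; it is then itself one of the subspaces whose intersection is
    [terwilliger]. *)
Lemma terwilliger_sub_terwilliger0 :
  (@terwilliger C T e w `<=` @terwilliger0 C T e w)%classic.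
Proof.
have adj_tilde i : @terwilliger_tilde C T e w (adj_mx C e i).
  move=> g /stabilizerP[Gg gw]; apply/perm_mx_on_commP => x y.
  by rewrite !mxE !enum_rankK assoc_rel_aut.
move=> X; apply.
- by apply: tilde_sub_terwilliger0 => g _; rewrite mulmx1 mul1mx.
- move=> Y Z Y0 Z0; apply: tilde_sub_terwilliger0 => g Gg.
  have Yg := terwilliger0_sub_tilde Y0 Gg; have Zg := terwilliger0_sub_tilde Z0 Gg.
  by rewrite mulmxA Yg -mulmxA Zg mulmxA.
- by move=> i; exact: tilde_sub_terwilliger0.
move=> i; apply: tilde_sub_terwilliger0 => g /stabilizerP[Gg gw].
apply/perm_mx_on_commP => x y; rewrite !mxE !enum_rankK !inE.
by rewrite !(can_eq (@enum_rankK T)) (inj_eq perm_inj) -{1}gw assoc_rel_aut.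
Qed.

End Algebra.

Lemma homogeneous_triply_transitive (R : realType) (x0 : T) :
  triply_transitive R e.
Proof.
split.
- exact: homogeneous_strongly_regular.
- exact: homogeneous_transitive.
move=> w.
have T0T : @terwilliger0 R[i] T e w = @terwilliger _ _ e w.
  by apply/seteqP; split; [exact: terwilliger0_sub_terwilliger
                          |exact: terwilliger_sub_terwilliger0].
split=> //; rewrite -T0T; apply/seteqP.
by split; [exact: terwilliger0_sub_tilde|exact: tilde_sub_terwilliger0].
Qed.

End Graph.

(** * Quadratic forms and hyperbolic extensions *)

Section QuadraticModules.
Local Open Scope ring_scope.
Variable F : fieldType.

Section Forms.
Variables (M : lmodType F) (q : M -> F).

Definition polar (x y : M) : F := q (x + y) - q x - q y.

Record quadratic_form : Prop := QuadraticForm {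
  quadraticZ : forall a x, q (a *: x) = a ^+ 2 * q x;
  polar_linearl : forall a x y z, polar (a *: x + y) z = a * polar x z + polar y z }.

Definition nondeg := forall x, x != 0 -> exists y, polar x y != 0.

(** On a nondegenerate space a similitude with nonzero multiplier is injective
    ([similitude_inj]), so that no inverse has to be carried along. *)
Definition similitude (l : F) (g : M -> M) :=
  linear g /\ forall x, q (g x) = l * q x.

Hypothesis q_quad : quadratic_form.

Lemma quadraticD x y : q (x + y) = q x + q y + polar x y.
Proof. by rewrite /polar; ring. Qed.

Lemma quadratic0 : q 0 = 0.
Proof. by rewrite -(scale0r 0) (quadraticZ q_quad) expr0n mul0r. Qed.

Lemma polarC x y : polar x y = polar y x.
Proof. by rewrite /polar (addrC y); ring. Qed.

Lemma polar0l z : polar 0 z = 0.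
Proof. by rewrite /polar add0r quadratic0 subr0 subrr. Qed.

Lemma polarZl a x z : polar (a *: x) z = a * polar x z.
Proof. by rewrite -(addr0 (a *: x)) (polar_linearl q_quad) polar0l addr0. Qed.

Lemma polarZr a x z : polar x (a *: z) = a * polar x z.
Proof. by rewrite polarC polarZl polarC. Qed.

Lemma polarxx x : polar x x = 2%:R * q x.
Proof. by rewrite /polar -mulr2n -scaler_nat (quadraticZ q_quad); ring. Qed.

Lemma polar_similitude l g x y : similitude l g -> polar (g x) (g y) = l * polar x y.
Proof.
case=> g_lin g_sim; have g_add : g (x + y) = g x + g y.
  by rewrite -{1}(scale1r x) g_lin scale1r.
by rewrite /polar -g_add !g_sim; ring.
Qed.

Lemma similitude_id : similitude 1 id.
Proof. by split=> // x; rewrite mul1r. Qed.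

Lemma similitude_comp l l' g h :
  similitude l g -> similitude l' h -> similitude (l * l') (g \o h).
Proof.
case=> g_lin g_sim [h_lin h_sim]; split=> [a x y|x] /=; first by rewrite h_lin g_lin.
by rewrite g_sim h_sim mulrA.
Qed.

Lemma isometry_comp g h :
  similitude 1 g -> similitude 1 h -> similitude 1 (g \o h).
Proof. by move=> g1 h1; rewrite -[X in similitude X](mulr1 1); exact: similitude_comp. Qed.

Lemma similitude_inj l g : nondeg -> l != 0 -> similitude l g -> injective g.
Proof.
move=> nd l0 gs x y gxy; apply/eqP; rewrite -subr_eq0; apply: contraT => /nd[z].
have gB : g (x - y) = 0.
  by rewrite addrC -scaleN1r gs.1 gxy scaleN1r addNr.
by have := polar_similitude (x - y) z gs; rewrite gB polar0l => /esym/eqP;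
   rewrite mulf_eq0 (negPf l0) => /eqP ->; rewrite eqxx.
Qed.

End Forms.

Section Hyperbolic.
Variables (M : lmodType F) (q : M -> F).

(** The orthogonal sum of a hyperbolic plane and [M]. Applying it twice to a binary
    form gives the six-dimensional space of the elliptic quadric. *)
Definition hyperbolic : lmodType F := (F^o * F^o * M)%type.

Definition hyp_form (x : hyperbolic) : F := (x.1.1 : F) * x.1.2 + q x.2.

Definition hyp_vec (a b : F) (m : M) : hyperbolic := (a, b, m).

Lemma hyp_vecE x : exists a b m, x = hyp_vec a b m.
Proof. by case: x => [[a b] m]; exists a, b, m. Qed.

Lemma hyp_vecD a b m a' b' m' :
  hyp_vec a b m + hyp_vec a' b' m' = hyp_vec (a + a') (b + b') (m + m').
Proof. by []. Qed.

Lemma hyp_vecZ c a b m : c *: hyp_vec a b m = hyp_vec (c * a) (c * b) (c *: m).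
Proof. by []. Qed.

Lemma hyp_formE a b m : hyp_form (hyp_vec a b m) = a * b + q m.
Proof. by []. Qed.

Lemma polar_hypE a b m a' b' m' :
  polar hyp_form (hyp_vec a b m) (hyp_vec a' b' m') = a * b' + b * a' + polar q m m'.
Proof. by rewrite /polar hyp_vecD !hyp_formE; ring. Qed.

Hypothesis q_quad : quadratic_form q.

Lemma hyp_quadratic : quadratic_form hyp_form.
Proof.
split=> [a x|a x y z].
  have [b [c [m ->]]] := hyp_vecE x.
  by rewrite hyp_vecZ !hyp_formE (quadraticZ q_quad); ring.
have [? [? [? ->]]] := hyp_vecE x; have [? [? [? ->]]] := hyp_vecE y.
have [? [? [? ->]]] := hyp_vecE z.
by rewrite hyp_vecZ hyp_vecD !polar_hypE (polar_linearl q_quad); ring.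
Qed.

Lemma hyp_nondeg : nondeg q -> nondeg hyp_form.
Proof.
move=> q_nd x; have [a [b [m ->]]] := hyp_vecE x => x0.
have [a0|a0] := eqVneq a 0; last first.
  exists (hyp_vec 0 1 0).
  by rewrite polar_hypE polarC polar0l //; rewrite mulr1 mulr0 !addr0.
have [b0|b0] := eqVneq b 0; last first.
  exists (hyp_vec 1 0 0).
  by rewrite polar_hypE polarC polar0l //; rewrite mulr1 mulr0 addr0 add0r.
have /q_nd[v mv] : m != 0 by apply: contraNneq x0 => ->; rewrite a0 b0.
by exists (hyp_vec 0 0 v); rewrite polar_hypE !mulr0 !add0r.
Qed.

(** The Siegel transformation (Eichler transvection) of the first vector of the
    hyperbolic pair: it fixes (1, 0, 0) and adds a multiple of [v] to [x.2]; the
    first coordinate is corrected so as to preserve the form. *)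
Definition siegel (v : M) (x : hyperbolic) : hyperbolic :=
  hyp_vec (x.1.1 - polar q x.2 v - (x.1.2 : F) * q v) x.1.2 (x.2 + x.1.2 *: v).
Definition hyp_swap (x : hyperbolic) : hyperbolic := hyp_vec x.1.2 x.1.1 x.2.
Definition hyp_lift (s t : F) (g : M -> M) (x : hyperbolic) : hyperbolic :=
  hyp_vec (s * x.1.1) (t * x.1.2) (g x.2).

Lemma siegelE v a b m :
  siegel v (hyp_vec a b m) = hyp_vec (a - polar q m v - b * q v) b (m + b *: v).
Proof. by []. Qed.

Lemma hyp_swapE a b m : hyp_swap (hyp_vec a b m) = hyp_vec b a m.
Proof. by []. Qed.

Lemma hyp_liftE s t g a b m :
  hyp_lift s t g (hyp_vec a b m) = hyp_vec (s * a) (t * b) (g m).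
Proof. by []. Qed.

Lemma siegel_isometry v : similitude hyp_form 1 (siegel v).
Proof.
split=> [c x y|x].
  have [a [b [m ->]]] := hyp_vecE x; have [a' [b' [m' ->]]] := hyp_vecE y.
  rewrite hyp_vecZ hyp_vecD !siegelE hyp_vecZ hyp_vecD (polar_linearl q_quad).
  congr (hyp_vec _ _ _); first by ring.
  by rewrite scalerDl scalerDr scalerA addrACA.
have [a [b [m ->]]] := hyp_vecE x.
by rewrite siegelE !hyp_formE quadraticD (quadraticZ q_quad) (polarZr q_quad); ring.
Qed.

Lemma hyp_swap_isometry : similitude hyp_form 1 hyp_swap.
Proof.
split=> [c x y|x] //; have [a [b [m ->]]] := hyp_vecE x.
by rewrite hyp_swapE !hyp_formE; ring.
Qed.

Lemma hyp_lift_similitude s t g :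
  similitude q (s * t) g -> similitude hyp_form (s * t) (hyp_lift s t g).
Proof.
move=> [g_lin g_sim]; split=> [c x y|x].
  have [a [b [m ->]]] := hyp_vecE x; have [a' [b' [m' ->]]] := hyp_vecE y.
  rewrite hyp_vecZ hyp_vecD !hyp_liftE hyp_vecZ hyp_vecD g_lin.
  by congr (hyp_vec _ _ _); ring.
have [a [b [m ->]]] := hyp_vecE x.
by rewrite hyp_liftE !hyp_formE g_sim; ring.
Qed.

Lemma hyp_scale_isometry s : s != 0 -> similitude hyp_form 1 (hyp_lift s s^-1 id).
Proof.
move=> s0; rewrite -(mulfV s0); apply: hyp_lift_similitude.
by rewrite mulfV //; exact: similitude_id.
Qed.

Hypothesis q_nd : nondeg q.

(** The form of Witt's theorem needed here: isometries are transitive on the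
    nonzero vectors of given value. If the second coordinate is nonzero, a Siegel
    transformation kills the component in [M] and a scaling of the hyperbolic
    pair normalizes the rest. If only the first one is nonzero, the two are
    swapped. If both vanish, a Siegel transformation along a [v] that is not
    orthogonal to the component in [M] makes the first one nonzero. *)
Lemma isometry_to_hyp_plane x : x != 0 ->
  exists2 g, similitude hyp_form 1 g & g x = hyp_vec (hyp_form x) 1 0.
Proof.
have from_snd a b m : b != 0 -> exists2 g, similitude hyp_form 1 g &
    g (hyp_vec a b m) = hyp_vec (hyp_form (hyp_vec a b m)) 1 0.
  move=> b0; pose s := siegel (- b^-1 *: m).
  exists (hyp_lift b b^-1 id \o s).
    by apply: isometry_comp; [exact: hyp_scale_isometry|exact: siegel_isometry].
  have := (siegel_isometry (- b^-1 *: m)).2 (hyp_vec a b m).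
  rewrite mul1r /= -/(s _) => <-; rewrite /s siegelE scalerA mulrN mulfV // scaleN1r subrr.
  by rewrite hyp_liftE hyp_formE mulVf // (quadratic0 q_quad) addr0 mulrC.
have [a [b [m ->]]] := hyp_vecE x => x0.
have from_fst a' b' m' : a' != 0 -> exists2 g, similitude hyp_form 1 g &
    g (hyp_vec a' b' m') = hyp_vec (hyp_form (hyp_vec a' b' m')) 1 0.
  move=> a0; have [g g_iso gE] := from_snd b' a' m' a0.
  exists (g \o hyp_swap); first by apply: isometry_comp => //; exact: hyp_swap_isometry.
  by rewrite /= hyp_swapE gE !hyp_formE mulrC.
have [b0|/from_snd//] := eqVneq b 0; have [a0|/from_fst//] := eqVneq a 0.
have /q_nd[v mv] : m != 0 by apply: contraNneq x0 => ->; rewrite a0 b0.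
have [|g g_iso gE] := from_fst (- polar q m v) 0 m; first by rewrite oppr_eq0.
exists (g \o siegel v); first by apply: isometry_comp => //; exact: siegel_isometry.
rewrite /= siegelE a0 b0 add0r scale0r addr0 mul0r subr0 gE.
by rewrite !hyp_formE !mulr0.
Qed.

End Hyperbolic.
End QuadraticModules.

(** * Binary quadratic forms over a finite field *)

Section BinaryForms.
Local Open Scope ring_scope.
Variable F : finFieldType.

Lemma char2_sqr_surj (c : F) : 2%:R = 0 :> F -> exists x : F, x ^+ 2 = c.
Proof.
move=> F2; have sqr_inj : injective (fun x : F => x ^+ 2).
  move=> x y /eqP; rewrite eqf_sqr => /orP[] /eqP-> //.
  by apply/eqP; rewrite -subr_eq0 -opprD oppr_eq0 -mulr2n -mulr_natl F2 mul0r.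
by have [g _ gK] := injF_bij sqr_inj; exists (g c); rewrite gK.
Qed.

(** Squaring is at most two-to-one and 0 has a single square root: choosing a
    root [r] of each square, the field is covered by the values of [r] together
    with their opposites at the nonzero squares. *)
Lemma card_squares : (#|F| < 2 * #|[set x ^+ 2 | x : F]|)%N.
Proof.
set A := imset _ _.
pose r (a : F) : F := odflt 0 [pick x | x ^+ 2 == a].
have rE x : r (x ^+ 2) ^+ 2 = x ^+ 2.
  by rewrite /r; case: pickP => [y /eqP|/(_ x)] //=; rewrite eqxx.
have A0 : 0 \in A by apply/imsetP; exists 0; rewrite ?expr0n.
have cover : [set: F] \subset (r @: A) :|: ((fun a => - r a) @: (A :\ 0)).
  apply/fintype.subsetP => x _; have Ax : x ^+ 2 \in A by apply/imsetP; exists x.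
  have /eqP := rE x; rewrite eqf_sqr inE => /orP[/eqP rx|/eqP rx].
    by rewrite -{1}rx imset_f.
  have [x0|x0] := eqVneq x 0.
    have -> : x = r (x ^+ 2) by rewrite rx x0 oppr0.
    by rewrite imset_f.
  apply/orP; right; apply/imsetP; exists (x ^+ 2); last by rewrite rx opprK.
  by rewrite !inE expf_eq0 x0.
have cardA : #|A| = #|A :\ 0|.+1 by rewrite (cardsD1 0 A) A0.
rewrite -cardsT (leq_ltn_trans (subset_leq_card cover)) //.
rewrite (leq_ltn_trans (leq_card_setU _ _)) //.
rewrite (leq_ltn_trans (leq_add (leq_imset_card _ _) (leq_imset_card _ _))) //.
by rewrite cardA mul2n -addnn ltn_add2l.
Qed.

(** Pigeonhole: the sets of the [x ^+ 2] and of the [c - d * y ^+ 2] each contain more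
    than half of the field. *)
Lemma sqrD_universal (d c : F) : d != 0 -> exists x y, x ^+ 2 + d * y ^+ 2 = c.
Proof.
move=> d0; set A := [set x ^+ 2 | x : F]; pose h a := c - d * a.
have h_inj : injective h.
  by move=> a b /(congr1 (fun z => c - z)); rewrite /h !subKr => /(mulfI d0).
have : A :&: (h @: A) != finset.set0.
  rewrite -card_gt0 -(ltn_add2l #|A :|: (h @: A)|) addn0 cardsUI (card_imset _ h_inj).
  by rewrite addnn -mul2n (leq_ltn_trans (max_card _)) ?card_squares.
case/set0Pn => z; rewrite inE => /andP[/imsetP[x _ ->] /imsetP[a]].
by case/imsetP => y _ -> E; exists x, y; rewrite E /h subrK.
Qed.

Variables (a b c : F).

Definition binary_form (n : (F^o * F^o)%type) : F :=
  a * (n.1 : F) ^+ 2 + b * (n.1 : F) * n.2 + c * (n.2 : F) ^+ 2.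

Lemma binary_quadratic : quadratic_form binary_form.
Proof.
split=> [k [s t]|k [s t] [s' t'] [s'' t'']]; rewrite /polar /binary_form /=.
  by rewrite -![_ *: _]/(_ * _); ring.
by rewrite -![_ *: _]/(_ * _); ring.
Qed.

Lemma polar_binaryE (s t s' t' : F) :
  polar binary_form (s, t) (s', t') =
    2%:R * (a * s * s' + c * t * t') + b * (s * t' + t * s').
Proof. by rewrite /polar /binary_form /=; ring. Qed.

Hypothesis anisotropic : forall n, binary_form n = 0 -> n = 0.

Lemma anisotropic_lead : a != 0.
Proof.
apply/eqP => a0; have /anisotropic[/eqP] : binary_form (1, 0) = 0.
  by rewrite /binary_form /= a0; ring.
by rewrite oner_eq0.
Qed.

(** In characteristic 2 the polar form is the alternating form with coefficient
    [b]; if [b] were 0 the form would be the square of a linear form, every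
    element being a square, and would have a nontrivial zero. *)
Lemma binary_nondeg : nondeg binary_form.
Proof.
have [F2|F2] := eqVneq (2%:R : F) 0; last first.
  move=> n n0; exists n; rewrite (polarxx binary_quadratic) mulf_neq0 //.
  by apply: contraNneq n0 => /anisotropic ->.
have b0 : b != 0.
  apply/eqP => b0; have [s sE] := char2_sqr_surj c F2; have [t tE] := char2_sqr_surj a F2.
  have /anisotropic[_ t0] : binary_form (s, t) = 0.
    by rewrite /binary_form /= sE tE b0 mul0r mul0r addr0 mulrC -mulr2n -mulr_natl F2 mul0r.
  by have := anisotropic_lead; rewrite -tE t0 expr0n eqxx.
move=> [s t] st0; have [s0|s0] := eqVneq s 0.
  exists (1, 0); rewrite polar_binaryE F2 mul0r add0r mulr0 mulr1 add0r mulf_neq0 //.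
  by apply: contraNneq st0 => t0; rewrite s0 t0.
by exists (0, 1); rewrite polar_binaryE F2 mul0r add0r mulr0 mulr1 addr0 mulf_neq0.
Qed.

(** The form x^2 + bxy + acy^2 is the norm form of the quadratic extension attached to
    [binary_form]. In characteristic 2 squares suffice; otherwise complete the
    square: the discriminant is nonzero by anisotropy. *)
Lemma norm_universal (l : F) : exists x y, x ^+ 2 + b * x * y + a * c * y ^+ 2 = l.
Proof.
have [F2|F2] := eqVneq (2%:R : F) 0.
  by have [x xE] := char2_sqr_surj l F2; exists x, 0; rewrite mulr0 expr0n mulr0 !addr0.
have [|x [y <-]] := @sqrD_universal (a * c - (b / 2%:R) ^+ 2) l.
  apply/eqP => d0; have /anisotropic[_ /eqP] : binary_form (- (b / 2%:R) / a, 1) = 0.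
    have a0 := anisotropic_lead.
    have -> : binary_form (- (b / 2%:R) / a, 1) = (a * c - (b / 2%:R) ^+ 2) / a.
      by rewrite /binary_form /=; field; rewrite a0.
    by rewrite d0 mul0r.
  by rewrite oner_eq0.
by exists (x - b / 2%:R * y), y; field.
Qed.

(** Up to the factor [a], the binary form is the norm of as + tw with
    w^2 = bw - ac; multiplication by x + yw is a similitude whose multiplier is
    the norm of x + yw. *)
Lemma binary_similitude (l : F) : exists g, similitude binary_form l g.
Proof.
have [x [y <-]] := norm_universal l.
exists (fun n => ((n.1 : F) * x - c * n.2 * y, a * n.1 * y + n.2 * x + b * n.2 * y)).
split=> [k [s t] [s' t']|[s t]]; last by rewrite /binary_form /=; ring.
have E1 : (k * s + s') * x - c * (k * t + t') * y =
  k * (s * x - c * t * y) + (s' * x - c * t' * y) by ring.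
have E2 : a * (k * s + s') * y + (k * t + t') * x + b * (k * t + t') * y =
  k * (a * s * y + t * x + b * t * y) + (a * s' * y + t' * x + b * t' * y) by ring.
exact: (congr2 pair E1 E2).
Qed.

End BinaryForms.

Section IrreducibleForms.
Local Open Scope ring_scope.
Variables (F : finFieldType) (f : {mpoly F[2]}).
Hypotheses (f_homog : f \is 2.-homog) (f_irr : irreducible_elt f).

Let i0 : 'I_2 := ord0.
Let i1 : 'I_2 := lift ord0 ord0.

Lemma mnm2_eq (m m' : 'X_{1..2}) : (m == m') = (m i0 == m' i0) && (m i1 == m' i1).
Proof.
apply/eqP/andP => [->|[/eqP E0 /eqP E1]]; first by rewrite !eqxx.
by apply/mnmP => i; case: (unliftP ord0 i) => [j|] ->; rewrite // (ord1 j).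
Qed.

Lemma binary_mpolyE : exists a b c : F,
  f = a *: 'X_i0 ^+ 2 + b *: ('X_i0 * 'X_i1) + c *: 'X_i1 ^+ 2.
Proof.
exists f@_(U_(i0) *+ 2), f@_(U_(i0) + U_(i1)), f@_(U_(i1) *+ 2).
apply/mpolyP => m; rewrite !mcoeffD !mcoeffZ !mpolyXn -mpolyXD !mcoeffX.
have [m2|m2] := eqVneq (mdeg m) 2%N; last first.
  rewrite (dhomog_nemf_coeff f_homog m2).
  have deg_neq (m' : 'X_{1..2}) : mdeg m' = 2%N -> (m' == m) = false.
    by move=> m'2; apply: contraNF m2 => /eqP <-; rewrite m'2.
  by rewrite !deg_neq ?mdegMn ?mdegD ?mdeg1 // !mulr0 !addr0.
have : (m i0 + m i1 = 2%N)%N by move: m2; rewrite mdegE !big_ord_recl big_ord0 addn0.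
have [E0 E1 E2] : [/\ (U_(i0) *+ 2 == m)%MM = (m i0 == 2%N) && (m i1 == 0%N),
    (U_(i0) + U_(i1) == m)%MM = (m i0 == 1%N) && (m i1 == 1%N) &
    (U_(i1) *+ 2 == m)%MM = (m i0 == 0%N) && (m i1 == 2%N)].
  by split; rewrite mnm2_eq ?mulmnE ?mnmDE !mnm1E /= ![_ == m _]eq_sym.
move=> m01; rewrite E0 E1 E2.
have [c0|[c1|c2]] : (m i0 = 2%N /\ m i1 = 0%N) \/ (m i0 = 1%N /\ m i1 = 1%N) \/
                    (m i0 = 0%N /\ m i1 = 2%N).
- by move: m01; case: (m i0) => [|[|[|?]]] //=; rewrite ?add0n => -[]; auto.
- move: E0; rewrite !c0.1 !c0.2 /= => /eqP ->; rewrite mulr1 !mulr0 !addr0 //.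
- move: E1; rewrite !c1.1 !c1.2 /= => /eqP ->; rewrite mulr1 !mulr0 addr0 add0r //.
by move: E2; rewrite !c2.1 !c2.2 /= => /eqP ->; rewrite mulr1 !mulr0 !add0r.
Qed.

Lemma mpoly_vanishing_nonunit (g : {mpoly F[2]}) v : g.@[v] = 0 -> g \isn't a GRing.unit.
Proof.
move=> g0; apply/negP => /(rmorph_unit (meval v : {rmorphism _ -> _})).
by rewrite /= g0 unitr0.
Qed.

(** A nontrivial zero of the form would split off a linear factor. *)
Lemma irreducible_binary_form : exists a b c : F,
  (forall v, f.@[v] = binary_form a b c (v i0, v i1)) /\
  (forall n, binary_form a b c n = 0 -> n = 0).
Proof.
have [a [b [c fE]]] := binary_mpolyE; exists a, b, c; split=> [v|[s t]].
  by rewrite fE !mevalD !mevalZ !expr2 !mevalM !mevalXU /binary_form /=; ring.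
have linear_nonunit (k l : F) :
    k *: 'X_i0 + l *: 'X_i1 \isn't a @GRing.unit {mpoly F[2]}.
  apply: (@mpoly_vanishing_nonunit _ (fun=> 0)).
  by rewrite mevalD !mevalZ !mevalXU !mulr0 addr0.
have not_product (k l k' l' : F) :
    f <> (k *: 'X_i0 + l *: 'X_i1) * (k' *: 'X_i0 + l' *: 'X_i1).
  case: f_irr => _ _ /[apply] -[]; exact/negP/linear_nonunit.
rewrite /binary_form /= => st0.
have [t0|t0] := eqVneq t 0.
  have [s0|s0] := eqVneq s 0; first by rewrite s0 t0.
  have a0 : a = 0.
    apply/eqP; move/eqP: st0; rewrite t0 mulr0 expr0n mulr0 !addr0.
    by rewrite mulf_eq0 expf_eq0 (negPf s0) orbF.
  by case: (not_product 0 1 b c); rewrite fE a0 -!mul_mpolyC; ring.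
pose r := s / t; have rE : a * r ^+ 2 + b * r + c = 0.
  have -> : a * r ^+ 2 + b * r + c = (a * s ^+ 2 + b * s * t + c * t ^+ 2) / t ^+ 2.
    by rewrite /r; field.
  by rewrite st0 mul0r.
case: (not_product 1 (- r) a (b + a * r)); rewrite fE.
have -> : c = - (a * r * r + b * r).
  by apply/eqP; rewrite -addr_eq0 addrC -mulrA -expr2 rE.
rewrite -!mul_mpolyC !(mpolyCN, mpolyCD, mpolyCM); ring.
Qed.

End IrreducibleForms.

(** * Normal forms of singular vectors *)

Section NormalForms.
Local Open Scope ring_scope.
Variables (F : fieldType) (N : lmodType F) (q : N -> F).
Hypotheses (q_quad : quadratic_form q) (q_nd : nondeg q).
Hypothesis q_aniso : forall n, q n = 0 -> n = 0.
Hypothesis q_sim : forall l, exists g, similitude q l g.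

Let W := hyperbolic N.
Let V := hyperbolic W.
Let qW : W -> F := hyp_form q.
Let Q : V -> F := hyp_form qW.
Let qW_quad : quadratic_form qW := hyp_quadratic q_quad.
Let qW_nd : nondeg qW := hyp_nondeg q_quad q_nd.

(** [e1] and [e2] form a hyperbolic pair, [e1] and [e3] span a totally singular
    plane, and [e_generic] is singular and orthogonal to neither [e1] nor [e2]. *)
Definition e1 : V := hyp_vec 1 0 0.
Definition e2 : V := hyp_vec 0 1 0.
Definition e3 : V := hyp_vec 0 0 (hyp_vec 0 1 0).
Definition e_generic : V := hyp_vec 1 (-1) (hyp_vec 1 1 0).

Lemma W_similitude l : exists g, similitude qW l g.
Proof.
have [h h_sim] := q_sim l; exists (hyp_lift l 1 h).
by rewrite -[l in similitude _ l _](mulr1 l); apply: hyp_lift_similitude; rewrite mulr1.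
Qed.

Lemma polar_e1 a b m : polar Q e1 (hyp_vec a b m) = b.
Proof. by rewrite polar_hypE polar0l //; ring. Qed.

Lemma polar_e2 a b m : polar Q e2 (hyp_vec a b m) = a.
Proof. by rewrite polar_hypE polar0l //; ring. Qed.

Lemma polar_e3 a b c d n : polar Q e3 (hyp_vec a b (hyp_vec c d n)) = c.
Proof. by rewrite !polar_hypE polar0l //; ring. Qed.

(** Scalars are allowed because the vectors only matter as generators of points. *)
Definition similitude_onto (p : seq (V * V)) :=
  exists l g, [/\ l != 0, similitude Q l g &
    forall xy, xy \in p -> exists2 c, c != 0 & g xy.1 = c *: xy.2].

Lemma normal_point x : x != 0 -> Q x = 0 -> similitude_onto [:: (x, e1)].
Proof.
move=> x0 Qx; have [g g_iso gx] := isometry_to_hyp_plane qW_quad qW_nd x0.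
exists 1, (@hyp_swap F W \o g); split; first exact: oner_neq0.
  by apply: isometry_comp => //; exact: hyp_swap_isometry.
move=> _ /[!inE] /eqP ->; exists 1; first exact: oner_neq0.
by rewrite /= gx -/Q Qx scale1r.
Qed.

(** A Siegel transformation clears the component of [x] in [W]; the first
    coordinate then vanishes because the vector is singular. *)
Lemma normal_pair_opp x : Q x = 0 -> polar Q e1 x != 0 ->
  similitude_onto [:: (e1, e1); (x, e2)].
Proof.
have [a [b [m ->]]] := hyp_vecE x; rewrite polar_e1 => Qx b0.
pose s := siegel qW (- b^-1 *: m).
have s_iso : similitude Q 1 s by exact: siegel_isometry.
exists 1, s; split=> //; first exact: oner_neq0.
move=> _ /[!inE] /orP[] /eqP -> /=.
  exists 1; first exact: oner_neq0.
  by rewrite /s siegelE polar0l // mul0r !subr0 scale0r addr0 scale1r.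
exists b => //; have := s_iso.2 (hyp_vec a b m); rewrite Qx mulr0 /s siegelE.
rewrite scalerA mulrN mulfV // scaleN1r subrr hyp_vecZ mulr0 mulr1 scaler0.
move: (_ - _ - _) => a'; rewrite /Q hyp_formE (quadratic0 qW_quad) addr0.
by move/eqP; rewrite mulf_eq0 (negPf b0) orbF => /eqP ->.
Qed.

Lemma similitude0 (M : lmodType F) (p : M -> F) l h : similitude p l h -> h 0 = 0.
Proof. by case=> h_lin _; have := h_lin (-1) 0 0; rewrite scaleN1r addNr scaleN1r addNr. Qed.

Lemma lift_to_e3 (m : W) : m != 0 -> qW m = 0 ->
  exists2 h, similitude qW 1 h & h m = hyp_vec 0 1 0.
Proof.
move=> m0 qm; have [h h_iso hm] := isometry_to_hyp_plane q_quad q_nd m0.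
by exists h => //; rewrite hm -/qW qm.
Qed.

(** [hyp_lift] fixes the points of [e1] and [e2], so it acts on the third vector
    of a triple while keeping a hyperbolic pair in place. *)
Lemma hyp_lift_onto s t h y y' c : s != 0 -> t != 0 -> similitude qW (s * t) h ->
  c != 0 -> hyp_lift s t h y = c *: y' ->
  similitude_onto [:: (e1, e1); (e2, e2); (y, y')].
Proof.
move=> s0 t0 h_sim c0 hy; exists (s * t), (hyp_lift s t h : V -> V).
split; [by rewrite mulf_neq0|exact: hyp_lift_similitude|].
have h0 := similitude0 h_sim.
move=> _ /[!inE] /or3P[] /eqP -> /=; last by exists c.
  by exists s => //; rewrite hyp_liftE h0 hyp_vecZ mulr0 mulr1 mulr0 scaler0.
by exists t => //; rewrite hyp_liftE h0 hyp_vecZ mulr0 mulr1 mulr0 scaler0.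
Qed.

(** A transitive action on the singular vectors of [W] straightens the component
    of [x] in [W]; a Siegel transformation then clears its coordinate on [e1]. *)
Lemma normal_pair_adj x : (forall c, x <> c *: e1) -> Q x = 0 -> polar Q e1 x = 0 ->
  similitude_onto [:: (e1, e1); (x, e3)].
Proof.
have [a [b [m ->]]] := hyp_vecE x; rewrite polar_e1 => x_e1 + b0.
rewrite b0 in x_e1 *; rewrite /Q hyp_formE mulr0 add0r => qm.
have m0 : m != 0.
  apply/eqP => m0; case: (x_e1 a).
  by rewrite m0 hyp_vecZ mulr1 mulr0 scaler0.
have [h h_iso hm] := lift_to_e3 m0 qm.
(* The lift sends m to (0, 1, 0), whose product with (a, 0, 0) is a. *)
exists 1, (siegel qW (hyp_vec a 0 0) \o hyp_lift 1 1 h : V -> V); split.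
- exact: oner_neq0.
- apply: isometry_comp; first exact: siegel_isometry.
  by rewrite -[X in similitude _ X _](mulr1 1); apply: hyp_lift_similitude; rewrite mulr1.
have h0 := similitude0 h_iso.
move=> _ /[!inE] /orP[] /eqP -> /=; exists 1; rewrite ?oner_neq0 // scale1r hyp_liftE.
  by rewrite h0 siegelE polar0l // mulr0 mul0r !subr0 mulr1 scale0r addr0.
rewrite hm siegelE polar_hypE polar0l // !mulr0 !mul1r !mul0r subr0 scale0r !addr0 add0r subrr.
by [].
Qed.

Definition normal_third (adj1 adj2 : bool) : V :=
  match adj1, adj2 with
  | true, true => e3
  | true, false => e1 + e3
  | false, true => e2 + e3
  | false, false => e_generic
  end.

(** The generic case is the one that needs more than isometries: the vector
    (a, b, m) has qW m = - ab, and the product ab is only determined up to squares by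
    the points, so a similitude of [W] has to rescale qW m to 1. *)
Lemma normal_triple_opp y :
  (forall c, y <> c *: e1) -> (forall c, y <> c *: e2) -> Q y = 0 ->
  similitude_onto [:: (e1, e1); (e2, e2);
              (y, normal_third (polar Q e1 y == 0) (polar Q e2 y == 0))].
Proof.
have [a [b [m ->]]] := hyp_vecE y; rewrite polar_e1 polar_e2 => y_e1 y_e2.
rewrite /Q hyp_formE => Qy.
have [b0|b0] := eqVneq b 0; have [a0|a0] := eqVneq a 0; rewrite /=.
- have m0 : m != 0.
    apply/eqP => m0; case: (y_e1 0).
    by rewrite a0 b0 m0 scale0r.
  have [|h h_iso hm] := lift_to_e3 m0; first by rewrite -Qy a0 mul0r add0r.
  apply: (@hyp_lift_onto 1 1 h _ _ 1); rewrite ?mulr1 ?oner_neq0 //.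
  by rewrite hyp_liftE hm a0 b0 !mulr0 scale1r.
- have m0 : m != 0.
    apply/eqP => m0; case: (y_e1 a).
    by rewrite b0 m0 hyp_vecZ mulr1 mulr0 scaler0.
  have [|h h_iso hm] := lift_to_e3 m0; first by rewrite -Qy b0 mulr0 add0r.
  apply: (@hyp_lift_onto a^-1 a h _ _ 1); rewrite ?mulVf ?invr_eq0 ?oner_neq0 //.
  by rewrite hyp_liftE hm b0 mulr0 mulVf // scale1r hyp_vecD !(addr0, add0r).
- have m0 : m != 0.
    apply/eqP => m0; case: (y_e2 b).
    by rewrite a0 m0 hyp_vecZ mulr1 mulr0 scaler0.
  have [|h h_iso hm] := lift_to_e3 m0; first by rewrite -Qy a0 mul0r add0r.
  apply: (@hyp_lift_onto b b^-1 h _ _ 1); rewrite ?mulfV ?invr_eq0 ?oner_neq0 //.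
  by rewrite hyp_liftE hm a0 mulr0 mulVf // scale1r hyp_vecD !(addr0, add0r).
have qm : qW m = - (a * b) by apply/eqP; rewrite -addr_eq0 addrC Qy.
have l0 : - (a * b)^-1 != 0 by rewrite oppr_eq0 invr_eq0 mulf_neq0.
have [h h_sim] := W_similitude (- (a * b)^-1).
have qhm : qW (h m) = 1 by rewrite h_sim.2 qm mulrNN mulVf // mulf_neq0.
have hm0 : h m != 0.
  by apply: contra_eq_neq qhm => ->; rewrite (quadratic0 qW_quad) eq_sym oner_neq0.
have [g g_iso gE] := isometry_to_hyp_plane q_quad q_nd hm0.
apply: (@hyp_lift_onto a^-1 (- b^-1) (g \o h) _ _ 1).
- by rewrite invr_eq0.
- by rewrite oppr_eq0 invr_eq0.
- rewrite mulrN -invfM -[X in similitude _ X _]mul1r; exact: similitude_comp.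
- exact: oner_neq0.
by rewrite hyp_liftE /= gE -/qW qhm mulNr !mulVf // scale1r.
Qed.

(** By anisotropy, a singular vector orthogonal to [e1] and [e3] lies in their
    span: the third point is on the line of the first two. *)
Lemma normal_triple_clique y : (forall c, y <> c *: e1) -> (forall c, y <> c *: e3) ->
  Q y = 0 -> polar Q e1 y = 0 -> polar Q e3 y = 0 ->
  similitude_onto [:: (e1, e1); (e3, e3); (y, e1 + e3)].
Proof.
have [a [b [m ->]]] := hyp_vecE y; have [c [d [n ->]]] := hyp_vecE m.
rewrite polar_e1 polar_e3 => y_e1 y_e3 + b0 c0; rewrite b0 c0 in y_e1 y_e3 *.
rewrite /Q /qW !hyp_formE mulr0 mul0r !add0r => /q_aniso n0; rewrite n0 in y_e1 y_e3 *.
have a0 : a != 0.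
  apply/eqP => a0; case: (y_e3 d).
  by rewrite a0 !hyp_vecZ !mulr0 mulr1 scaler0.
have d0 : d != 0.
  apply/eqP => d0; case: (y_e1 a).
  by rewrite d0 !hyp_vecZ !mulr0 mulr1 scaler0.
have s0 : d / a != 0 by rewrite mulf_neq0 // invr_eq0.
exists 1, (hyp_lift (d / a) (d / a)^-1 id : V -> V); split.
- exact: oner_neq0.
- exact: hyp_scale_isometry.
move=> _ /[!inE] /or3P[] /eqP -> /=.
- by exists (d / a) => //; rewrite hyp_liftE hyp_vecZ !mulr0 mulr1 scaler0.
- by exists 1; rewrite ?oner_neq0 // hyp_liftE scale1r !mulr0.
exists d => //; rewrite hyp_liftE hyp_vecD !(addr0, add0r) hyp_vecZ.
by rewrite divfK // hyp_vecZ !mulr0 !mulr1 scaler0.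
Qed.

End NormalForms.

(** * The collinearity graph of the elliptic quadric *)

Section EllipticPoints.
Local Open Scope ring_scope.
Variables (F : finFieldType) (f : {mpoly F[2]}) (a b c : F).
Let q := binary_form a b c.
Hypothesis fE : forall v, f.@[v] = q (v ord0, v (lift ord0 ord0)).
Hypothesis q_aniso : forall n, q n = 0 -> n = 0.

Let N : lmodType F := (F^o * F^o)%type.
Let V : lmodType F := hyperbolic (hyperbolic N).
Let Q : V -> F := hyp_form (hyp_form q).
Let q_quad : quadratic_form q := binary_quadratic a b c.
Let q_nd : nondeg q := binary_nondeg q_aniso.
Let Q_quad : quadratic_form Q := hyp_quadratic (hyp_quadratic q_quad).
Let Q_nd : nondeg Q := hyp_nondeg (hyp_quadratic q_quad) (hyp_nondeg q_quad q_nd).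

Local Notation point := (elliptic_point f).
Local Notation e := (@elliptic_collinear F f).

Definition coords (x : 'rV[F]_6) : V :=
  hyp_vec (x 0 0) (x 0 1) (hyp_vec (x 0 2) (x 0 3)
    ((x 0 (rshift 4 (ord0 : 'I_2)), x 0 (rshift 4 (lift ord0 ord0 : 'I_2))) : N)).

Definition of_coords (v : V) : 'rV[F]_6 :=
  \row_i [:: v.1.1 : F; v.1.2; v.2.1.1; v.2.1.2; v.2.2.1; v.2.2.2]`_i.

Lemma of_coordsK : cancel of_coords coords.
Proof. by case=> [[v0 v1] [[v2 v3] [v4 v5]]]; rewrite /coords /of_coords !mxE. Qed.

Lemma coordsK : cancel coords of_coords.
Proof.
move=> x; apply/rowP => i; rewrite mxE.
by case: i => [[|[|[|[|[|[|?]]]]]] // i_lt] /=; congr (x 0 _); apply/val_inj.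
Qed.

Lemma coords_linear : linear coords.
Proof. by move=> k x y; rewrite /coords !mxE. Qed.

Lemma of_coords_linear : linear of_coords.
Proof.
by move=> k x y; apply: (can_inj coordsK); rewrite coords_linear !of_coordsK.
Qed.

Lemma of_coordsZ k v : of_coords (k *: v) = k *: of_coords v.
Proof.
have of0 : of_coords 0 = 0.
  by have := of_coords_linear (-1) 0 0; rewrite scaleN1r addNr scaleN1r addNr.
by rewrite -[k *: v]addr0 of_coords_linear of0 addr0.
Qed.

Lemma of_coords_eq0 v : (of_coords v == 0) = (v == 0).
Proof.
by rewrite -(inj_eq (can_inj of_coordsK) v 0) -(scale0r (0 : V)) of_coordsZ scale0r.
Qed.

Lemma elliptic_formE v : elliptic_form f (of_coords v) = Q v.
Proof.
rewrite -[in RHS](of_coordsK v); move: (of_coords v) => x.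
by rewrite /elliptic_form fE /Q /coords !hyp_formE -addrA.
Qed.

Lemma elliptic_bilinE u v :
  elliptic_bilin f (of_coords u) (of_coords v) = polar Q u v.
Proof.
rewrite /elliptic_bilin !elliptic_formE -(scale1r (of_coords u)) -of_coords_linear.
by rewrite scale1r elliptic_formE.
Qed.

Definition spans (U : point) (v : V) := val U = <[of_coords v]>%VS.

Lemma spansP U : exists v, [/\ v != 0, Q v = 0 & spans U v].
Proof.
have /existsP[x /and3P[x0 /eqP fx /eqP Ux]] := valP U.
exists (coords x); rewrite -of_coords_eq0 -elliptic_formE /spans coordsK.
by split.
Qed.

Lemma spans_exists v : v != 0 -> Q v = 0 -> exists U, spans U v.
Proof.
move=> v0 Qv.
have Pv : [exists x : 'rV[F]_6,
    [&& x != 0, elliptic_form f x == 0 & <[of_coords v]>%VS == <[x]>%VS]].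
  by apply/existsP; exists (of_coords v); rewrite of_coords_eq0 v0 elliptic_formE Qv !eqxx.
by exists (Sub <[of_coords v]>%VS Pv).
Qed.

Lemma spans_inj U W v : spans U v -> spans W v -> U = W.
Proof. by move=> Uv Wv; apply: val_inj; rewrite Uv Wv. Qed.

Lemma spansZ U k v : k != 0 -> spans U (k *: v) <-> spans U v.
Proof.
move=> k0; suff E : <[of_coords (k *: v)]>%VS = <[of_coords v]>%VS by rewrite /spans E.
apply/eqP; rewrite eqEsubv -!memvE of_coordsZ memvZ ?memv_line //=.
by apply/vlineP; exists k^-1; rewrite scalerA mulVf ?scale1r.
Qed.

Lemma spans_prop U u v : spans U u -> spans U v -> exists2 k, k != 0 & v = k *: u.
Proof.
move=> Uu Uv; have [w [w0 _ Uw]] := spansP U.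
have v0 : v != 0.
  apply: contraNneq w0 => v0; rewrite -of_coords_eq0 -memv0.
  have -> : 0%VS = <[of_coords v]>%VS.
    by apply/eqP; rewrite eq_sym -subv0 -memvE memv0 of_coords_eq0 v0.
  by rewrite -Uv Uw memv_line.
have /vlineP[k vk] : of_coords v \in <[of_coords u]>%VS by rewrite -Uu Uv memv_line.
have {}vk : v = k *: u by apply: (can_inj of_coordsK); rewrite vk of_coordsZ.
by exists k => //; apply: contraNneq v0 => k0; rewrite vk k0 scale0r.
Qed.

Lemma spans_nonprop U W u v : U != W -> spans U u -> spans W v ->
  forall k, v <> k *: u.
Proof.
move=> UW Uu Wv k vk; case/eqP: UW; apply: (spans_inj Uu).
have [k0|k0] := eqVneq k 0; last by apply/(spansZ _ _ k0); rewrite -vk.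
have [w [w0 _ Ww]] := spansP W; have [l _ wl] := spans_prop Wv Ww.
by move: w0; rewrite wl vk k0 scale0r scaler0 eqxx.
Qed.

Lemma collinearE U W u v : spans U u -> spans W v ->
  e U W = (U != W) && (polar Q u v == 0).
Proof.
move=> Uu Wv; rewrite /elliptic_collinear; congr (_ && _).
apply/existsP/eqP => [[x /existsP[y /and3P[/eqP Ux /eqP Wy /eqP xy]]]|uv].
  rewrite -(coordsK x) in Ux xy; rewrite -(coordsK y) in Wy xy.
  have [k _ ->] := spans_prop Ux Uu; have [l _ ->] := spans_prop Wy Wv.
  by rewrite (polarZl Q_quad) (polarZr Q_quad) -elliptic_bilinE xy !mulr0.
exists (of_coords u); apply/existsP; exists (of_coords v).
by rewrite elliptic_bilinE uv -Uu -Wv !eqxx.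
Qed.

Lemma collinear_sym : ssrbool.symmetric e.
Proof.
move=> U W; have [u [_ _ Uu]] := spansP U; have [w [_ _ Ww]] := spansP W.
by rewrite (collinearE Uu Ww) (collinearE Ww Uu) eq_sym polarC.
Qed.

Lemma collinear_irr : irreflexive e.
Proof. by move=> U; rewrite /elliptic_collinear eqxx. Qed.

(** The bridge from vectors to the graph: a similitude permutes the singular
    points and preserves orthogonality. *)
Lemma similitude_aut (l : F) g : l != 0 -> similitude Q l g ->
  exists2 s, s \in graph_aut e & forall U u, spans U u -> spans (s U) (g u).
Proof.
move=> l0 g_sim; pose h x := of_coords (g (coords x)).
have h_lin : linear h.
  by move=> k x y; rewrite /h coords_linear g_sim.1 of_coords_linear.
pose hL : {linear 'rV[F]_6 -> 'rV[F]_6} :=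
  HB.pack h (GRing.isLinear.Build _ _ _ _ h h_lin).
pose H := linfun hL.
have HE x : H x = h x by rewrite lfunE.
have H_inj : lker H == 0%VS.
  apply/lker0P => x y; rewrite !HE => /(can_inj of_coordsK).
  by move/(similitude_inj Q_quad Q_nd l0 g_sim)/(can_inj coordsK).
have H_line u : (H @: <[of_coords u]>)%VS = <[of_coords (g u)]>%VS.
  by rewrite limg_line HE /h of_coordsK.
pose s (U : point) : point := insubd U (H @: val U)%VS.
have s_spans U u : spans U u -> spans (s U) (g u).
  have [v [v0 Qv Uv]] := spansP U; move=> Uu.
  rewrite /spans -H_line -Uu /s val_insubd Uv H_line ifT //.
  apply/existsP; exists (of_coords (g v)).
  rewrite of_coords_eq0 elliptic_formE g_sim.2 Qv mulr0 !eqxx !andbT.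
  apply: contraNneq v0 => gv0; apply/eqP.
  by apply: (similitude_inj Q_quad Q_nd l0 g_sim); rewrite gv0 (similitude0 g_sim).
have s_inj : injective s.
  move=> U W sUW; have [u [_ _ Uu]] := spansP U; have [w [_ _ Ww]] := spansP W.
  have := s_spans _ _ Uu; rewrite sUW => Wgu; have Wgw := s_spans _ _ Ww.
  have : val (s U) = val (s W) by rewrite sUW.
  rewrite (s_spans _ _ Uu) (s_spans _ _ Ww) -!H_line => /eqP.
  by rewrite eqEsubv !(limg_ker0 _ _ H_inj) -eqEsubv -Uu -Ww => /eqP/val_inj.
exists (perm s_inj); last by move=> U u Uu; rewrite permE; exact: s_spans.
rewrite inE; apply/forallP => U; apply/forallP => W; apply/eqP; rewrite !permE.
have [u [_ _ Uu]] := spansP U; have [w [_ _ Ww]] := spansP W.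
rewrite (collinearE Uu Ww) (collinearE (s_spans _ _ Uu) (s_spans _ _ Ww)).
by rewrite (inj_eq s_inj) (polar_similitude _ _ g_sim) mulf_eq0 (negPf l0).
Qed.

Local Notation e1 := (e1 N).
Local Notation e2 := (e2 N).
Local Notation e3 := (e3 N).

Lemma onto_aut p : similitude_onto q p ->
  exists2 s, s \in graph_aut e &
    forall U xy, xy \in p -> spans U xy.1 -> spans (s U) xy.2.
Proof.
case=> l [g [l0 g_sim gp]]; have [s Gs s_spans] := similitude_aut l0 g_sim.
exists s => // U xy /gp[k k0 gxy] /s_spans; rewrite gxy => h; exact/(spansZ _ _ k0).
Qed.

Lemma aut_normal_point w : exists2 s, s \in graph_aut e & spans (s w) e1.
Proof.
have [x [x0 Qx wx]] := spansP w.
have [s Gs s_spans] := onto_aut (normal_point q_quad q_nd x0 Qx).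
by exists s => //; apply: (s_spans _ (x, e1)); rewrite ?inE.
Qed.

Lemma aut_normal_pair w x : w != x -> exists2 s, s \in graph_aut e &
  spans (s w) e1 /\ spans (s x) (if e w x then e3 else e2).
Proof.
move=> wx; have [s1 Gs1 w1] := aut_normal_point w.
have [v [v0 Qv xv]] := spansP (s1 x).
have s1wx : s1 w != s1 x by rewrite (inj_eq perm_inj).
have v_e1 := spans_nonprop s1wx w1 xv.
have eE : e w x = (polar Q e1 v == 0).
  by rewrite -(graph_autE _ _ Gs1) (collinearE w1 xv) s1wx.
have [s Gs [s_w s_x]] : exists2 s, s \in graph_aut e & spans (s (s1 w)) e1 /\
    spans (s (s1 x)) (if e w x then e3 else e2).
  rewrite eE; case: eqP => [e1v|/eqP e1v].
    have [s Gs s_spans] := onto_aut (normal_pair_adj q_quad q_nd v_e1 Qv e1v).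
    exists s => //; split; first by apply: (s_spans _ (e1, e1)); rewrite ?inE ?eqxx.
    by apply: (s_spans _ (v, e3)); rewrite ?inE ?eqxx ?orbT.
  have [s Gs s_spans] := onto_aut (normal_pair_opp q_quad Qv e1v).
  exists s => //; split; first by apply: (s_spans _ (e1, e1)); rewrite ?inE ?eqxx.
  by apply: (s_spans _ (v, e2)); rewrite ?inE ?eqxx ?orbT.
by exists (s1 * s)%g; rewrite ?groupM // !permM.
Qed.

(** The hypothesis on cliques leaves the triples whose first pair is nonadjacent
    or that are pairwise adjacent; the others reduce to these by reordering. *)
Lemma aut_normal_triple w x y : w != x -> w != y -> x != y ->
  (e w x -> e w y && e x y) ->
  exists2 s, s \in graph_aut e &
    [/\ spans (s w) e1, spans (s x) (if e w x then e3 else e2) &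
        spans (s y) (if e w x then e1 + e3 else normal_third N (e w y) (e x y))].
Proof.
move=> wx wy xy clique; set r := (if e w x then e1 + e3 else _).
have [s1 Gs1 [w1 x1]] := aut_normal_pair wx.
have [v [v0 Qv yv]] := spansP (s1 y).
have s1wy : s1 w != s1 y by rewrite (inj_eq perm_inj).
have s1xy : s1 x != s1 y by rewrite (inj_eq perm_inj).
have v_e1 := spans_nonprop s1wy w1 yv; have v_x := spans_nonprop s1xy x1 yv.
have wyE : e w y = (polar Q e1 v == 0).
  by rewrite -(graph_autE _ _ Gs1) (collinearE w1 yv) s1wy.
have xyE : e x y = (polar Q (if e w x then e3 else e2) v == 0).
  by rewrite -(graph_autE _ _ Gs1) (collinearE x1 yv) s1xy.
suff /onto_aut[s Gs s_spans] : similitude_onto q [:: (e1, e1);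
    (if e w x then e3 else e2, if e w x then e3 else e2); (v, r)].
  exists (s1 * s)%g; rewrite ?groupM // !permM; split.
  - by apply: (s_spans _ (e1, e1)); rewrite ?inE ?eqxx.
  - by apply: (s_spans _ (_, _) _ x1); rewrite ?inE ?eqxx ?orbT.
  - by apply: (s_spans _ (v, r)); rewrite ?inE ?eqxx ?orbT.
rewrite {}/r; case: (e w x) clique v_x xyE => [/(_ isT)/andP[ewy exy]|_] v_x xyE.
  move: wyE xyE; rewrite ewy exy => /esym/eqP e1v /esym/eqP e3v.
  exact: (normal_triple_clique q_quad q_aniso v_e1 v_x Qv e1v e3v).
rewrite wyE xyE; apply: normal_triple_opp => //; exact: binary_similitude.
Qed.

Lemma spans_conj (s s' : {perm point}) U U' v : spans (s U) v -> spans (s' U') v ->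
  (s * s'^-1)%g U = U'.
Proof. by move=> sU sU'; rewrite permM (spans_inj sU sU') permK. Qed.

(** A triple with a nonadjacent pair is permuted so that this pair comes first;
    what remains is a repeated point, or three points of one line. *)
Lemma collinear_homogeneous : triple_homogeneous e.
Proof.
have pair w x w' x' : same_rel e w x w' x' ->
    exists2 s, s \in graph_aut e & s w = w' /\ s x = x'.
  move=> /andP[/eqP eqE /eqP eE]; have [wx|wx] := eqVneq w x.
    have /eqP <- : w' == x' by rewrite -eqE wx.
    have [s Gs ws] := aut_normal_point w; have [s' Gs' ws'] := aut_normal_point w'.
    exists (s * s'^-1)%g; rewrite ?groupM ?groupV // -wx; split;
      exact: spans_conj ws ws'.
  have [s Gs [sw sx]] := aut_normal_pair wx.
  have [|s' Gs' [sw' sx']] := @aut_normal_pair w' x'; first by rewrite -eqE.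
  rewrite -eE in sx'; exists (s * s'^-1)%g; rewrite ?groupM ?groupV //.
  by split; [exact: spans_conj sw sw'|exact: spans_conj sx sx'].
have triple w x y w' x' y' : w != x -> w != y -> x != y ->
    (e w x -> e w y && e x y) ->
    same_rel e w x w' x' -> same_rel e w y w' y' -> same_rel e x y x' y' ->
    exists2 s, s \in graph_aut e & [/\ s w = w', s x = x' & s y = y'].
  move=> wx wy xy cl /andP[/eqP wxE /eqP ewx] /andP[/eqP wyE /eqP ewy].
  move=> /andP[/eqP xyE /eqP exy].
  have [s Gs [sw sx sy]] := aut_normal_triple wx wy xy cl.
  have [|||| s' Gs' [sw' sx' sy']] := @aut_normal_triple w' x' y'.
  - by rewrite -wxE.
  - by rewrite -wyE.
  - by rewrite -xyE.
  - by rewrite -ewx -ewy -exy.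
  rewrite -ewx in sx'; rewrite -ewx -ewy -exy in sy'.
  exists (s * s'^-1)%g; rewrite ?groupM ?groupV //.
  by split; [exact: spans_conj sw sw'|exact: spans_conj sx sx'|exact: spans_conj sy sy'].
have same_relC x y x' y' : same_rel e x y x' y' -> same_rel e y x y' x'.
  by rewrite /same_rel !(eq_sym y) !(eq_sym y') !(collinear_sym y) !(collinear_sym y').
move=> w x y w' x' y' wx wy xy.
have eq_same u v u' v' : same_rel e u v u' v' -> u = v -> u' = v'.
  by move=> /andP[/eqP E _] uv; apply/eqP; rewrite -E uv.
have [E|nwx] := eqVneq w x.
  have E' := eq_same _ _ _ _ wx E; have [s Gs [sw sy]] := pair _ _ _ _ wy.
  by exists s; rewrite -?E -?E'.
have [E|nwy] := eqVneq w y.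
  have E' := eq_same _ _ _ _ wy E; have [s Gs [sw sx]] := pair _ _ _ _ wx.
  by exists s; rewrite -?E -?E'.
have [E|nxy] := eqVneq x y.
  have E' := eq_same _ _ _ _ xy E; have [s Gs [sw sx]] := pair _ _ _ _ wx.
  by exists s; rewrite -?E -?E'.
have [ewx|newx] := boolP (e w x); last by apply: triple => //; rewrite (negPf newx).
have [ewy|newy] := boolP (e w y); last first.
  have nyx : y != x by rewrite eq_sym.
  have cl : e w y -> e w x && e y x by rewrite (negPf newy).
  have [s Gs [? ? ?]] := triple _ _ _ _ _ _ nwy nwx nyx cl wy wx (same_relC _ _ _ _ xy).
  by exists s.
have [exy|nexy] := boolP (e x y); first by apply: triple => //; rewrite ewy exy.
have nxw : x != w by rewrite eq_sym.
have nyw : y != w by rewrite eq_sym.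
have cl : e x y -> e x w && e y w by rewrite (negPf nexy).
by have [s Gs [? ? ?]] := triple _ _ _ _ _ _ nxy nxw nyw cl xy (same_relC _ _ _ _ wx)
     (same_relC _ _ _ _ wy); exists s.
Qed.

End EllipticPoints.

Theorem theorem3p4 (R : realType) (p n : nat) (p_prime : prime p)
  (n_gt0 : (0 < n)%N) (F : finFieldType) (cardF : #|F| = (p ^ n)%N)
  (f : {mpoly F[2]}) (f_homog : f \is 2.-homog) (f_irr : irreducible_elt f) :
  triply_transitive R (@elliptic_collinear F f).
Proof.
have [a [b [c [fE q_aniso]]]] := irreducible_binary_form f_homog f_irr.
have [||U _] := spans_exists fE (v := e1 _).
- by apply/eqP => /(congr1 (fun v => v.1.1)) /eqP; rewrite oner_eq0.
- by rewrite !hyp_formE /binary_form /=; ring.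
apply: (homogeneous_triply_transitive _ _ _ R U).
- exact: collinear_sym.
- exact: collinear_irr.
exact: collinear_homogeneous.
Qed.
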